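(* Let $A$ be an abelian group, $L$ a loop with the inverse property containing no elements of order $3$, and $(P,Q)$ a loop cocycle, $P,Q:L\times L\to\mathrm{Aut}(A)$, such that $F(P,Q)$ is a strongly linear abelian extension of $A$ by $L$. Then $F(P,Q)$ has the inverse property if and only if the map $(P,Q):L\times L\to\mathrm{Aut}(A)\times\mathrm{Aut}(A)$, $(\xi,\eta)\mapsto(P(\xi,\eta),Q(\xi,\eta))$, is equivariant for the actions of $\Gamma=\{\iota,\varphi,\psi,\varphi\psi\varphi,\psi\varphi,\varphi\psi\}$ on $L\times L$ and on $\mathrm{Aut}(A)\times\mathrm{Aut}(A)$, i.e. $$\big(P(\tau(\xi,\eta)),\,Q(\tau(\xi,\eta))\big)=\tau\big(P(\xi,\eta),\,Q(\xi,\eta)\big)\quad\text{for all }\tau\in\Gamma,\ \xi,\eta\in L.$$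
   Context: A loop is a set with a binary multiplication having a two-sided identity element such that all left and right translations are bijections. A loop $L$ has the left (resp. right) inverse property if there is a bijection $\iota:L\to L$ with $\iota(x)\cdot xy=y$ (resp. $yx\cdot\iota(x)=y$) for all $x,y\in L$; then left and right inverses of every $x$ coincide and $\iota(x)=x^{-1}$. It has the inverse property if it has both. In a loop with the inverse property and identity $\epsilon$, an element of order $3$ is an element $\xi\ne\epsilon$ with $\xi\xi\cdot\xi=\epsilon$. Let $A=(A,+)$ be a commutative group and $L$ a loop with identity $\epsilon$. A loop cocycle is a pair $(P,Q)$ of maps $P,Q:L\times L\to\mathrm{Aut}(A)$ with $P(\alpha,\epsilon)=\mathrm{Id}=Q(\epsilon,\beta)$ for all $\alpha,\beta\in L$. The linear abelian extension $F(P,Q)$ of $A$ by $L$ is the loop on $L\times A$ with multiplication $(\alpha,a)\cdot(\beta,b)=(\alpha\beta,\,P(\alpha,\beta)a+Q(\alpha,\beta)b)$. It is strongly linear abelian if $(\epsilon,a)\cdot(\beta,b)=(\beta,b)\cdot(\epsilon,a)=(\beta,a+b)$ for all $a,b\in A$, $\beta\in L$; equivalently $P(\xi,\epsilon)=P(\epsilon,\xi)=\mathrm{Id}=Q(\xi,\epsilon)=Q(\epsilon,\xi)$ for all $\xi\in L$. The group $\Gamma\cong S_3$ is generated by two involutions $\varphi,\psi$ with $(\varphi\psi)^3=1$. Its six elements act on $L\times L$ and on $\mathrm{Aut}(A)\times\mathrm{Aut}(A)$ by (with $\mathcal P,\mathcal Q\in\mathrm{Aut}(A)$): - $\iota$: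 $(\xi,\eta)\mapsto(\xi,\eta)$; $(\mathcal P,\mathcal Q)\mapsto(\mathcal P,\mathcal Q)$. - $\varphi$: $(\xi,\eta)\mapsto(\xi^{-1},\xi\eta)$; $(\mathcal P,\mathcal Q)\mapsto(\mathcal Q^{-1}\mathcal P,\mathcal Q^{-1})$. - $\psi$: $(\xi,\eta)\mapsto(\xi\eta,\eta^{-1})$; $(\mathcal P,\mathcal Q)\mapsto(\mathcal P^{-1},\mathcal P^{-1}\mathcal Q)$. - $\varphi\psi\varphi$: $(\xi,\eta)\mapsto(\eta^{-1},\xi^{-1})$; $(\mathcal P,\mathcal Q)\mapsto(\mathcal Q,\mathcal P)$. - $\psi\varphi$: $(\xi,\eta)\mapsto(\eta,(\xi\eta)^{-1})$; $(\mathcal P,\mathcal Q)\mapsto(\mathcal P^{-1}\mathcal Q,\mathcal P^{-1})$. - $\varphi\psi$: $(\xi,\eta)\mapsto((\xi\eta)^{-1},\xi)$; $(\mathcal P,\mathcal Q)\mapsto(\mathcal Q^{-1},\mathcal Q^{-1}\mathcal P)$. *)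

(* Defs.v *)
From HB Require Import structures.
From mathcomp Require Import all_boot all_algebra boolp.

Set Implicit Arguments.
Unset Strict Implicit.
Unset Printing Implicit Defensive.

Import GRing.Theory.
Local Open Scope group_scope.

HB.mixin Record UMagma_isLoop L of UMagma L := {
  ltrans_bij : forall x : L, bijective (fun y : L => x * y);
  rtrans_bij : forall x : L, bijective (fun y : L => y * x)
}.

#[short(type="loopType")]
HB.structure Definition Loop := {L of UMagma_isLoop L & UMagma L}.

Bind Scope group_scope with Loop.sort.

Definition left_inverse_property (L : loopType) :=
  exists2 iota : L -> L, bijective iota & forall x y, iota x * (x * y) = y.

Definition right_inverse_property (L : loopType) :=
  exists2 iota : L -> L, bijective iota & forall x y, (y * x) * iota x = y.

Definition inverse_property (L : loopType) :=
  left_inverse_property L /\ right_inverse_property L.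

Definition has_order3 (L : loopType) (x : L) := x <> 1 /\ (x * x) * x = 1.

Section LoopInverse.
Variable L : loopType.
Implicit Types x y : L.

Lemma linv_subproof x : exists y, y * x == 1.
Proof. by have [g _ gK] := rtrans_bij x; exists (g 1); apply/eqP/gK. Qed.

(* The unique y with y * x = 1, which exists in every loop. Under the inverse
   property it is two-sided and is the map iota of either one-sided property:
   see linv_left and linv_right. *)
Definition linv x : L := xchoose (linv_subproof x).

Lemma linvP x : linv x * x = 1.
Proof. exact/eqP/(xchooseP (linv_subproof x)). Qed.

Lemma linv_uniq x y : y * x = 1 -> y = linv x.
Proof. by move=> yx1; apply: (bij_inj (rtrans_bij x)); rewrite linvP. Qed.

Lemma linv_left (iota : L -> L) :
  (forall x y, iota x * (x * y) = y) -> iota =1 linv.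
Proof. by move=> iK x; apply: linv_uniq; have := iK x 1; rewrite mulg1. Qed.

Lemma linv_right (iota : L -> L) :
  (forall x y, (y * x) * iota x = y) -> iota =1 linv.
Proof. by move=> iK x; have := iK x (linv x); rewrite linvP mul1g. Qed.

Hypothesis ipL : inverse_property L.

Lemma linvKl x y : linv x * (x * y) = y.
Proof. by have [[i _ iK] _] := ipL; rewrite -(linv_left iK). Qed.

Lemma linvKr x y : (y * x) * linv x = y.
Proof. by have [_ [i _ iK]] := ipL; rewrite -(linv_right iK). Qed.

Lemma linvK x : linv (linv x) = x.
Proof. by have := linvKl (linv x) x; rewrite linvP mulg1. Qed.

Lemma linvM x y : linv (x * y) = linv y * linv x.
Proof.
by rewrite -[in linv y](linvKl (x * y) (linv y)) !linvKr.
Qed.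

End LoopInverse.

(* The inverse map is stored as data, but it is determined by the underlying
   additive map, so Leibniz equality is equality of maps (autP). *)
Record addaut (A : zmodType) := AddAut {
  aut_fun :> {additive A -> A};
  aut_inv : A -> A;
  aut_funK : cancel aut_fun aut_inv;
  aut_invK : cancel aut_inv aut_fun
}.

Section AutGroup.
Variable A : zmodType.
Implicit Types f g h : addaut A.

Lemma additiveP (f g : {additive A -> A}) : f =1 g -> f = g.
Proof.
case: f g => [f [[f1]]] [g [[g1]]] /= /funext fg; subst g.
by rewrite (Prop_irrelevance f1 g1).
Qed.

Lemma autP f g : f =1 g -> f = g.
Proof.
case: f g => [f i fi if_] [g j gj jg] /= /additiveP fg; subst g.
have ij : i = j by apply/funext => x; rewrite -[x in LHS]jg fi.
by subst j; rewrite (Prop_irrelevance fi gj) (Prop_irrelevance if_ jg).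
Qed.

Definition aut_one : addaut A :=
  @AddAut A (idfun : {additive A -> A}) id (fun=> erefl) (fun=> erefl).

Definition aut_mul f g : addaut A :=
  @AddAut A (f \o g : {additive A -> A}) (aut_inv g \o aut_inv f)
    (can_comp (aut_funK f) (aut_funK g)) (can_comp (aut_invK g) (aut_invK f)).

Lemma aut_inv_zmod f : zmod_morphism (aut_inv f).
Proof. exact: can2_zmod_morphism (aut_funK f) (aut_invK f). Qed.

Definition aut_inv_additive f : {additive A -> A} :=
  HB.pack (aut_inv f)
    (GRing.isZmodMorphism.Build A A (aut_inv f) (aut_inv_zmod f)).

Definition aut_V f : addaut A :=
  @AddAut A (aut_inv_additive f) f (aut_invK f) (aut_funK f).

(* groupType requires a choiceType; for arbitrary A it is classical. *)
HB.instance Definition _ := gen_eqMixin (addaut A).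
HB.instance Definition _ := gen_choiceMixin (addaut A).

Lemma aut_mulA : associative aut_mul. Proof. by move=> f g h; apply: autP. Qed.
Lemma aut_mul1 : left_id aut_one aut_mul. Proof. by move=> f; apply: autP. Qed.
Lemma aut_mulr1 : right_id aut_one aut_mul. Proof. by move=> f; apply: autP. Qed.
Lemma aut_mulV : left_inverse aut_one aut_V aut_mul.
Proof. by move=> f; apply: autP => x /=; rewrite aut_funK. Qed.
Lemma aut_mulrV : right_inverse aut_one aut_V aut_mul.
Proof. by move=> f; apply: autP => x /=; rewrite aut_invK. Qed.

HB.instance Definition _ :=
  isGroup.Build (addaut A) aut_mulA aut_mul1 aut_mulr1 aut_mulV aut_mulrV.

End AutGroup.

Section LinearExtension.
Variables (A : zmodType) (L : loopType).
Implicit Types P Q : L * L -> addaut A.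

Definition loop_cocycle P Q :=
  (forall x : L, P (x, 1) = 1) /\ (forall y : L, Q (1, y) = 1).

Definition linear_extension P Q of loop_cocycle P Q : Type := (L * A)%type.

Section Loop.
Variables (P Q : L * L -> addaut A) (PQ : loop_cocycle P Q).
Local Notation F := (linear_extension PQ).

HB.instance Definition _ := Choice.copy F (L * A)%type.

Definition ext_mul (u v : F) : F :=
  (u.1 * v.1, (P (u.1, v.1) u.2 + Q (u.1, v.1) v.2)%R).

Definition ext_one : F := (1, 0%R).

HB.instance Definition _ := hasMul.Build F ext_mul.

Fact ext_mul1 : left_id ext_one ext_mul.
Proof.
by case=> x a; rewrite /ext_mul /= mul1g raddf0 add0r (proj2 PQ).
Qed.

Fact ext_mulr1 : right_id ext_one ext_mul.
Proof.
by case=> x a; rewrite /ext_mul /= mulg1 raddf0 addr0 (proj1 PQ).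
Qed.

HB.instance Definition _ := Magma_isUMagma.Build F ext_mul1 ext_mulr1.

Lemma ext_mulE (u v : F) :
  u * v = (u.1 * v.1, (P (u.1, v.1) u.2 + Q (u.1, v.1) v.2)%R).
Proof. by []. Qed.

Fact ext_ltrans_bij (u : F) : bijective (fun v : F => u * v).
Proof.
case: u => x a; have [g fK gK] := ltrans_bij x.
exists (fun w : F =>
  (g w.1, aut_inv (Q (x, g w.1)) (w.2 - P (x, g w.1) a)%R)).
  by case=> y b; rewrite ext_mulE /= fK addrC addKr aut_funK.
by case=> z c; rewrite ext_mulE /= gK aut_invK addrC subrK.
Qed.

Fact ext_rtrans_bij (u : F) : bijective (fun v : F => v * u).
Proof.
case: u => y b; have [g fK gK] := rtrans_bij y.
exists (fun w : F =>
  (g w.1, aut_inv (P (g w.1, y)) (w.2 - Q (g w.1, y) b)%R)).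
  by case=> x a; rewrite ext_mulE /= fK addrK aut_funK.
by case=> z c; rewrite ext_mulE /= gK aut_invK subrK.
Qed.

HB.instance Definition _ := UMagma_isLoop.Build F ext_ltrans_bij ext_rtrans_bij.

Definition strongly_linear_abelian :=
  forall (a b : A) (y : L),
    ((1, a) : F) * ((y, b) : F) = (y, (a + b)%R) /\
    ((y, b) : F) * ((1, a) : F) = (y, (a + b)%R).

End Loop.
End LinearExtension.

(* The six elements of Gamma = S_3. In a composite name the rightmost factor
   acts first, so Gpsiphi is phi followed by psi. *)
Inductive Gamma := Gid | Gphi | Gpsi | Gphipsiphi | Gpsiphi | Gphipsi.

Definition Gamma_loop (L : loopType) (t : Gamma) (p : L * L) : L * L :=
  let: (x, y) := p in
  match t with
  | Gid => (x, y)
  | Gphi => (linv x, x * y)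
  | Gpsi => (x * y, linv y)
  | Gphipsiphi => (linv y, linv x)
  | Gpsiphi => (y, linv (x * y))
  | Gphipsi => (linv (x * y), x)
  end.

Definition Gamma_aut (A : zmodType) (t : Gamma) (p : addaut A * addaut A) :
    addaut A * addaut A :=
  let: (f, g) := p in
  match t with
  | Gid => (f, g)
  | Gphi => (g^-1 * f, g^-1)
  | Gpsi => (f^-1, f^-1 * g)
  | Gphipsiphi => (g, f)
  | Gpsiphi => (f^-1 * g, f^-1)
  | Gphipsi => (g^-1, g^-1 * f)
  end.

Definition Gamma_equivariant (A : zmodType) (L : loopType)
    (PQ : L * L -> addaut A * addaut A) :=
  forall (t : Gamma) (p : L * L), PQ (Gamma_loop t p) = Gamma_aut t (PQ p).

(* Multiplication table of S_3, for which Gamma_aut and, under the inverse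
   property, Gamma_loop are left actions (Gamma_autM, Gamma_loopM). *)
Definition Gamma_mul (s t : Gamma) : Gamma :=
  match s, t with
  | Gid, r | r, Gid => r
  | Gphi, Gphi | Gpsi, Gpsi | Gphipsiphi, Gphipsiphi => Gid
  | Gpsiphi, Gphipsi | Gphipsi, Gpsiphi => Gid
  | Gphi, Gpsi | Gpsi, Gphipsiphi | Gphipsiphi, Gphi => Gphipsi
  | Gpsiphi, Gpsiphi => Gphipsi
  | Gpsi, Gphi | Gphi, Gphipsiphi | Gphipsiphi, Gpsi => Gpsiphi
  | Gphipsi, Gphipsi => Gpsiphi
  | Gphi, Gphipsi | Gphipsi, Gphipsiphi | Gphipsiphi, Gpsiphi => Gpsi
  | Gpsiphi, Gphi => Gpsi
  | Gpsi, Gpsiphi | Gpsiphi, Gphipsiphi | Gphipsiphi, Gphipsi => Gphi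
  | Gphipsi, Gpsi => Gphi
  | Gphi, Gpsiphi | Gpsiphi, Gpsi | Gpsi, Gphipsi => Gphipsiphi
  | Gphipsi, Gphi => Gphipsiphi
  end.

Lemma Gamma_mulA : associative Gamma_mul.
Proof. by do 3!case. Qed.

Lemma Gamma_loopM (L : loopType) : inverse_property L -> forall s t (p : L * L),
  Gamma_loop (Gamma_mul s t) p = Gamma_loop s (Gamma_loop t p).
Proof.
move=> ip s t [x y].
have Kl (u v : L) : u * (linv u * v) = v by rewrite -{1}(linvK ip u) linvKl.
have Kr (u v : L) : (v * linv u) * u = v by rewrite -{2}(linvK ip u) linvKr.
case: s; case: t;
  by rewrite /= ?(linvKl ip, linvKr ip) ?(linvM ip) ?(linvK ip, Kl, Kr).
Qed.

Lemma Gamma_autM (A : zmodType) s t (p : addaut A * addaut A) :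
  Gamma_aut (Gamma_mul s t) p = Gamma_aut s (Gamma_aut t p).
Proof.
case: p => f g; case: s; case: t => //=;
by rewrite ?(invgM, invgK, mulgA, mulgV, mulVg, mul1g, mulgVK, mulgK).
Qed.

(* Main.v *)
Require Import Defs.
From mathcomp Require Import all_boot all_algebra.

(** The map [(x, a) |-> (x^-1, -a)] is the only candidate for the inverse map
    of an extension with the inverse property, and for this map the two
    cancellation laws
      [(x^-1, -a) * ((x, a) * (y, b)) = (y, b)]  and
      [((x, a) * (y, b)) * (y^-1, -b) = (x, a)]
    are equations in the fibre [A], additive in [a] and in [b]. Separating the
    coefficients of [a] and [b] turns the left law into equivariance under
    [phi] and the right law into equivariance under [psi]
    ([left_cancel_equivariant], [right_cancel_equivariant]). Since [phi] and
    [psi] generate [Gamma], this is equivariance under the whole group.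

    What needs an argument is that inverses in the extension do have the form
    [(x^-1, -a)]: inverting [(x, a)] involves [P (x^-1, x)] and
    [Q (x^-1, x)] ([linv_ext]). Both are the identity in a strongly linear
    abelian extension with the inverse property. Indeed the laws for fibre
    components equal to [0], where the inverse is obvious, already give
    [P (x * y, y^-1) * P (x, y) = 1] and [Q (x^-1, x * y) * Q (x, y) = 1];
    setting [x = 1] in the first and [y = 1] in the second leaves the two
    normalisations [P (1, y) = 1] and [Q (x, 1) = 1] of [strong_normalised]. *)

Set Implicit Arguments.
Unset Strict Implicit.
Unset Printing Implicit Defensive.

Import GRing.Theory.
Local Open Scope group_scope.

Section Equivariance.
Variables (A : zmodType) (L : loopType) (PQ : L * L -> addaut A * addaut A).

Definition equivariant_at (t : Gamma) :=
  forall p : L * L, PQ (Gamma_loop t p) = Gamma_aut t (PQ p).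

Lemma equivariant_atM s t : inverse_property L ->
  equivariant_at s -> equivariant_at t -> equivariant_at (Gamma_mul s t).
Proof. by move=> ipL es et p; rewrite Gamma_loopM // es et Gamma_autM. Qed.

Lemma equivariant_generators : inverse_property L ->
  equivariant_at Gphi -> equivariant_at Gpsi -> Gamma_equivariant PQ.
Proof.
move=> ipL ephi epsi.
have epsiphi : equivariant_at Gpsiphi := equivariant_atM ipL epsi ephi.
have ephipsi : equivariant_at Gphipsi := equivariant_atM ipL ephi epsi.
case=> //; first by case=> x y; case: (PQ _).
exact: (equivariant_atM ipL ephipsi ephi).
Qed.

End Equivariance.

Section AutLemmas.
Variable A : zmodType.
Implicit Types f g : addaut A.

Lemma aut_invD f (a b : A) : aut_inv f (a + b)%R = (aut_inv f a + aut_inv f b)%R.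
Proof. exact: (raddfD f^-1). Qed.

Lemma aut_invN f (a : A) : aut_inv f (- a)%R = (- aut_inv f a)%R.
Proof. exact: (raddfN f^-1). Qed.

Lemma aut_inv_uniq f g : (forall a, g (f a) = a) -> g = f^-1.
Proof. by move=> gf; apply: divg1_eq; rewrite invgK; apply: autP. Qed.

End AutLemmas.

Section Extension.
Variables (A : zmodType) (L : loopType) (P Q : L * L -> addaut A).
Variable PQ : loop_cocycle P Q.
Hypothesis ipL : inverse_property L.

Local Notation F := (linear_extension PQ).
Local Notation PxQ := (fun p : L * L => (P p, Q p)).

Lemma strong_normalised : strongly_linear_abelian PQ ->
  (forall y, P (1, y) = 1) /\ (forall x, Q (x, 1) = 1).
Proof.
move=> sla; split=> z; apply: autP => a.
  by have [/(congr1 snd) /=] := sla a 0%R z; rewrite raddf0 !addr0.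
by have [_ /(congr1 snd) /=] := sla a 0%R z; rewrite raddf0 add0r addr0.
Qed.

(** A left inverse is unique, so the equation in the fibre over [1] is all that
    is left to solve; its coefficients are the values at [(x^-1, x)]. *)
Lemma linv_ext (x : L) (a a' : A) :
  (P (linv x, x) a' + Q (linv x, x) a)%R = 0%R ->
  linv ((x, a) : F) = (linv x, a').
Proof. by move=> eq0; apply/esym/linv_uniq; rewrite ext_mulE /= eq0 linvP. Qed.

Lemma linv_ext0 (x : L) : linv ((x, 0%R) : F) = (linv x, 0%R).
Proof. by apply: linv_ext; rewrite !raddf0 addr0. Qed.

Definition ext_opp (u : F) : F := (linv u.1, (- u.2)%R).

Lemma ext_opp_bij : bijective ext_opp.
Proof.
by exists ext_opp; case=> x a; rewrite /ext_opp /= linvK // opprK.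
Qed.

Lemma left_cancel_Q :
  (forall x (v : F), ext_opp (x, 0%R) * (((x, 0%R) : F) * v) = v) ->
  forall x y, Q (linv x, x * y) = (Q (x, y))^-1.
Proof.
move=> cancel x y; apply: aut_inv_uniq => b.
have /(congr1 snd) := cancel x (y, b).
by rewrite /= oppr0 !raddf0 !add0r.
Qed.

Lemma right_cancel_P :
  (forall y (u : F), (u * ((y, 0%R) : F)) * ext_opp (y, 0%R) = u) ->
  forall x y, P (x * y, linv y) = (P (x, y))^-1.
Proof.
move=> cancel x y; apply: aut_inv_uniq => a.
have /(congr1 snd) := cancel y (x, a).
by rewrite /= oppr0 !raddf0 !addr0.
Qed.

(** Comparing the coefficients of [b] and then of [a] in
    [P' (- a) + Q' (P a + Q b) = b] gives [Q' = Q^-1] and [P' = Q^-1 P], where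
    [(P', Q')] is the value of the cocycle at [phi (x, y)]. *)
Lemma left_cancel_equivariant :
  (forall u v : F, ext_opp u * (u * v) = v) <-> equivariant_at PxQ Gphi.
Proof.
split=> [cancel [x y] | ephi [x a] [y b]].
- have Qphi : Q (linv x, x * y) = (Q (x, y))^-1 by apply: left_cancel_Q.
  rewrite /= Qphi; congr pair; apply: autP => a.
  have /(congr1 snd) := cancel (x, a) (y, 0%R).
  by rewrite /= Qphi !raddf0 addr0 raddfN addrC => /subr0_eq.
- have [Pphi Qphi] := ephi (x, y).
  rewrite !ext_mulE /ext_opp /= linvKl // Pphi Qphi; congr pair => /=.
  by rewrite !raddfN aut_invN aut_invD aut_funK addKr.
Qed.

(** The mirror image: now [P' (P a + Q b) + Q' (- b) = a], with [(P', Q')] the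
    value at [psi (x, y)]. *)
Lemma right_cancel_equivariant :
  (forall u v : F, (u * v) * ext_opp v = u) <-> equivariant_at PxQ Gpsi.
Proof.
split=> [cancel [x y] | epsi [x a] [y b]].
- have Ppsi : P (x * y, linv y) = (P (x, y))^-1.
    by apply: right_cancel_P => z u; apply: cancel.
  rewrite /= Ppsi; congr pair; apply: autP => b.
  have /(congr1 snd) := cancel (x, 0%R) (y, b).
  by rewrite /= Ppsi !raddf0 add0r raddfN => /subr0_eq.
- have [Ppsi Qpsi] := epsi (x, y).
  rewrite !ext_mulE /ext_opp /= linvKr // Ppsi Qpsi; congr pair => /=.
  by rewrite !raddfN aut_invN aut_invD aut_funK addrK.
Qed.

(** The coefficients in [linv_ext] are trivial because
    [(x^-1, x) = psi (1, x^-1) = phi (x, 1)]: the cancellation laws with fibre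
    component [0] carry [P = 1] from [(1, x^-1)] and [Q = 1] from [(x, 1)] to
    this pair. *)
Lemma linv_ext_opp : strongly_linear_abelian PQ -> inverse_property F ->
  forall u : F, linv u = ext_opp u.
Proof.
move=> /strong_normalised[P1 Q1] ipF [x a].
have opp0 z : ext_opp (z, 0%R) = linv ((z, 0%R) : F).
  by rewrite linv_ext0 /ext_opp /= oppr0.
have PV : P (linv x, x) = 1.
  have cancel z u : (u * ((z, 0%R) : F)) * ext_opp (z, 0%R) = u.
    by rewrite opp0; apply: linvKr.
  have := right_cancel_P cancel 1 (linv x).
  by rewrite mul1g linvK // P1 invg1.
have QV : Q (linv x, x) = 1.
  have cancel z v : ext_opp (z, 0%R) * (((z, 0%R) : F) * v) = v.
    by rewrite opp0; apply: linvKl.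
  by have := left_cancel_Q cancel x 1; rewrite mulg1 Q1 invg1.
by apply: linv_ext; rewrite PV QV /= addNr.
Qed.

End Extension.

Theorem lemma10 (A : zmodType) (L : loopType) (P Q : L * L -> addaut A)
    (PQ : loop_cocycle P Q) :
  inverse_property L ->
  (forall x : L, ~ has_order3 x) ->
  strongly_linear_abelian PQ ->
  inverse_property (linear_extension PQ) <->
  Gamma_equivariant (fun p : L * L => (P p, Q p)).
Proof.
move=> ipL _ sla; split=> [ipF | equiv].
- have linvE := linv_ext_opp ipL sla ipF.
  apply: equivariant_generators => //.
    by apply/(left_cancel_equivariant PQ ipL) => u v; rewrite -linvE linvKl.
  by apply/(right_cancel_equivariant PQ ipL) => u v; rewrite -linvE linvKr.
- split; exists (@ext_opp A L P Q PQ); try exact: ext_opp_bij.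
    exact/left_cancel_equivariant/(equiv Gphi).
  by move=> v u; move: u v; apply/right_cancel_equivariant/(equiv Gpsi).
Qed.
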